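(* Let $I\subseteq\mathbb{R}\setminus\{0\}$ be an interval, let $a,b\in I$ with $a<b$, let $q>1$, and let $f:I\to\mathbb{R}$ be differentiable on the interior $I^{\circ}$ and at every point of $[a,b]$ (one-sidedly if $a$ or $b$ is an endpoint of $I$). Let $h:[a,b]\to[0,\infty)$ be differentiable and such that $f h'$ is integrable on $[a,b]$. If $|f'|^q$ is harmonically-convex on $[a,b]$, then $$\left|\left[h(b)-2h(a)\right]\frac{f(a)}{2}+h(b)\frac{f(b)}{2}-\int_a^b f(x)h'(x)\,dx\right|$$ $$\le\frac{b-a}{4ab}\Bigg\{\left(\int_0^1|2h(L(t))-h(b)|\,dt\right)^{1-\frac1q}\left(\int_0^1|2h(L(t))-h(b)|\left(t(L(t))^{2q}|f'(a)|^q+(1-t)(L(t))^{2q}|f'(H)|^q\right)dt\right)^{\frac1q}$$ $$+\left(\int_0^1|2h(U(t))-h(b)|\,dt\right)^{1-\frac1q}\left(\int_0^1|2h(U(t))-h(b)|\left(t(U(t))^{2q}|f'(b)|^q+(1-t)(U(t))^{2q}|f'(H)|^q\right)dt\right)^{\frac1q}\Bigg\}.$$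
   Context: Notation: $H=H(a,b)=\frac{2ab}{a+b}$, and for $t\in[0,1]$, $L(t)=\frac{aH}{tH+(1-t)a}$ and $U(t)=\frac{bH}{tH+(1-t)b}$. For real $x$, $x^{2q}$ means $(x^2)^q$. A function $\psi:[a,b]\to\mathbb{R}$ (with $0\notin[a,b]$) is harmonically-convex if $\psi\left(\frac{xy}{tx+(1-t)y}\right)\le t\psi(y)+(1-t)\psi(x)$ for all $x,y\in[a,b]$ and $t\in[0,1]$. *)

(* Defs.v *)
From HB Require Import structures.
From mathcomp Require Import all_boot all_order all_algebra.
From mathcomp Require Import all_classical all_reals all_analysis.

Set Implicit Arguments.
Unset Strict Implicit.
Unset Printing Implicit Defensive.

Import Order.TTheory GRing.Theory Num.Theory.
Import numFieldNormedType.Exports.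

Local Open Scope classical_set_scope.
Local Open Scope ring_scope.

(* A function on an interval D is given by a total function R -> R whose values
   off D are irrelevant: for x in D the difference quotient is only taken at
   points of D, so its limit is the usual derivative when x is interior to D
   and the one-sided derivative when x is an endpoint of D. *)
Definition diff_quotient (R : realType) (f : R -> R) (x : R) : R -> R :=
  fun y => (f y - f x) / (y - x).

Definition derivable_within (R : realType) (D : set R) (f : R -> R) (x : R) :
    Prop :=
  cvg (diff_quotient f x y @[y --> within D x^']).

(* Meaningful only where [derivable_within D f x] holds. *)
Definition derive_within (R : realType) (D : set R) (f : R -> R) (x : R) : R :=
  lim (diff_quotient f x y @[y --> within D x^']).

Definition Hmean (R : realType) (a b : R) : R := 2 * a * b / (a + b).

Definition Lpt (R : realType) (a b t : R) : R :=
  a * Hmean a b / (t * Hmean a b + (1 - t) * a).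

Definition Upt (R : realType) (a b t : R) : R :=
  b * Hmean a b / (t * Hmean a b + (1 - t) * b).

(* Intended for intervals [a, b] that do not contain 0. *)
Definition harmonically_convex (R : realType) (a b : R) (psi : R -> R) : Prop :=
  forall x y t : R, x \in `[a, b] -> y \in `[a, b] -> t \in `[0, 1] ->
    psi (x * y / (t * x + (1 - t) * y)) <= t * psi y + (1 - t) * psi x.

(* Main.v *)
Require Import Defs.
From HB Require Import structures.
From mathcomp Require Import all_boot all_order all_algebra.
From mathcomp Require Import all_classical all_reals all_analysis.
From mathcomp Require Import measurable_realfun.
From mathcomp Require Import ring lra.

Set Implicit Arguments.
Unset Strict Implicit.
Unset Printing Implicit Defensive.

Import Order.TTheory GRing.Theory Num.Theory.
Import numFieldNormedType.Exports.

Local Open Scope classical_set_scope.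
Local Open Scope ring_scope.

(* With w = |2h - h(b)| and u = h - h(b)/2, integration by parts turns the left
   side into |int_a^b u f'| <= (1/2) int_a^b w |f'|.  On each of the two halves
   [a, H] and [H, b] the harmonic convexity of |f'|^q gives, at the point
   x = L(t) (resp. U(t)), |f'(x)| <= (t |f'(c)|^q + (1-t) |f'(H)|^q)^(1/q), c
   being a (resp. b); this majorant is continuous, so the substitution x = L(t),
   |dx| = (b - a) / (2ab) L(t)^2 dt applies, and Hoelder's inequality for the
   weight w o L concludes.

   The derivatives of h and f need not be continuous, so the integration by
   parts rests on the Lebesgue form of the fundamental theorem of calculus: a
   function differentiable at every point of [a, b] with an integrable
   derivative is the integral of that derivative.  It is obtained by comparing
   the derivative with a lower semicontinuous majorant whose integral is almost
   the same, after truncating the derivative from below. *)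

(** * The Lebesgue fundamental theorem of calculus for everywhere differentiable functions *)

(** Supremum argument: the points up to which the bound holds form a set containing [a]; continuity
    of [G] puts its supremum in the set, and [Gu] goes past any supremum smaller than [b]. Half-open
    intervals keep successive pieces disjoint. *)
Lemma ge0_increment_le_integral (R : realType) (a b : R) (G : R -> R)
    (u : R -> \bar R) (ab : a <= b)
    (m_u : measurable_fun `[a, b] u)
    (u0 : forall x, x \in `[a, b] -> (0 <= u x)%E)
    (cG : {within `[a, b], continuous G})
    (Gu : forall x, x \in `[a, b[ -> \forall y \near x^'+,
       ((G y - G x)%:E <= \int[@lebesgue_measure R]_(z in `]x, y]) u z)%E) :
  ((G b - G a)%:E <= \int[@lebesgue_measure R]_(z in `[a, b]) u z)%E.
Proof.
have u0' : forall A : set R, A `<=` `[a, b]%classic ->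
  forall x, A x -> (0 <= u x)%E by move=> A AS x /AS; exact: u0.
have mS : forall A : set R, A `<=` `[a, b]%classic -> measurable_fun A u
  by move=> A AS; exact: measurable_funS m_u.
have sub_ab x y : a <= x -> y <= b -> `]x, y]%classic `<=` `[a, b]%classic.
  move=> ax yb z/=; rewrite !in_itv/= => /andP[xz zy].
  by rewrite (le_trans ax (ltW xz)) (le_trans zy yb).
pose S := [set x | x \in `[a, b] /\
  ((G x - G a)%:E <= \int[@lebesgue_measure R]_(z in `]a, x]) u z)%E].
have Sa : S a.
  split; first by rewrite in_itv/= lexx.
  by rewrite subrr integral_ge0// => x; apply: u0'; exact: sub_ab.
have Sb : ubound S b by move=> x [+ _]; rewrite in_itv/= => /andP[].
have supS : has_sup S by split; [exists a|exists b].
pose s := sup S.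
have as_ : a <= s by apply: ub_le_sup => //; case: supS.
have sb : s <= b by apply: ge_sup => //; case: supS.
have Ss : S s.
  split; first by rewrite in_itv/= as_ sb.
  apply/lee_addgt0Pr => e e0.
  have /(subspace_continuousP _ _).1/(_ s) := cG.
  rewrite /= in_itv/= as_ sb => /(_ isT)/cvgrPdist_lt/(_ e e0).
  rewrite near_withinE => /nbhs_ballP[d /= d0 Bd].
  have [x [xab Gx] sx] := sup_adherent d0 supS.
  have xs : x <= s by apply: ub_le_sup; [case: supS|split].
  have := Bd x; rewrite /ball/= ger0_norm ?subr_ge0// ltrBlDr -ltrBlDl => /(_ sx xab).
  move=> /(le_lt_trans (ler_norm _)) Ge.
  rewrite (_ : G s - G a = (G x - G a) + (G s - G x)); last first.
    by rewrite [RHS]addrC addrA subrK.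
  rewrite EFinD leeD//; last by rewrite lee_fin ltW.
  rewrite (le_trans Gx)// ge0_subset_integral//=.
  - by apply: mS; exact: sub_ab.
  - by apply: u0'; exact: sub_ab.
  - by apply: subset_itvl; rewrite bnd_simp.
have [sE|sb'] := eqVneq s b.
  case: Ss => _; rewrite sE => /le_trans; apply.
  rewrite ge0_subset_integral//=; exact: sub_ab.
have {}sb' : s < b by rewrite lt_neqAle sb'.
suff [y sy Sy] : exists2 y, s < y & S y.
  by have := @ub_le_sup _ S supS.2 y Sy; rewrite leNgt sy.
near s^'+ => y; exists y => //.
have yb : y <= b by near: y; exact: nbhs_right_le.
have sy : s <= y by [].
split; first by rewrite in_itv/= (le_trans as_)//.
rewrite (_ : G y - G a = (G s - G a) + (G y - G s)); last by rewrite [RHS]addrC addrA subrK.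
have -> : `]a, y]%classic = `]a, s]%classic `|` `]s, y]%classic :> set R.
  by rewrite -itv_bndbnd_setU// bnd_simp.
rewrite ge0_integral_setU//=.
- rewrite EFinD leeD//; first by case: Ss.
  by near: y; apply: Gu; rewrite in_itv/= as_.
- by apply: mS; rewrite subUset; split; apply: sub_ab => //; exact: le_trans as_ _.
- by apply: u0'; rewrite subUset; split; apply: sub_ab => //; exact: le_trans as_ _.
- apply/disj_set2P; rewrite -subset0 => z [/=]; rewrite !in_itv/= => /andP[_ zs] /andP[+ _].
  by rewrite ltNge zs.
Unshelve. all: by end_near. Qed.

(* The layers [E k] of [w] are covered by open sets [V k] with excess [A k]; on
   [V k] the function [w + d + sum_k (k+1) d 1_(A k)] is at least [(k+1) d],
   hence locally at least a constant exceeding [w]. *)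
Lemma lsc_majorant (R : realType) (D : set R) (w : R -> R) (eps : R)
    (mD : measurable D) (Dfin : (lebesgue_measure D < +oo)%E)
    (mw : measurable_fun D w) (w0 : forall x, D x -> 0 <= w x)
    (eps0 : 0 < eps) :
  exists u : R -> \bar R,
    [/\ measurable_fun D u, (forall x, D x -> (0 <= u x)%E),
        (\int[@lebesgue_measure R]_(x in D) u x <=
         \int[@lebesgue_measure R]_(x in D) (w x)%:E + eps%:E)%E &
        forall x, D x -> exists2 c, w x < c &
          \forall y \near x, D y -> (c%:E <= u y)%E].
Proof.
pose mu := @lebesgue_measure R.
have muDfin : mu D \is a fin_num by rewrite ge0_fin_numE.
pose m := fine (mu D).
have m0 : 0 <= m by exact: fine_ge0.
(* Half of [eps] pays for the constant [d] integrated over [D], the other half for the excesses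
   [A k]. The [+ 1] in [d] avoids a division by 0 when [D] is null. *)
pose e := eps / 2.
have e0 : 0 < e by rewrite divr_gt0.
pose d := e / (m + 1).
have d0 : 0 < d by rewrite divr_gt0// ltr_wpDl.
pose E k := D `&` w @^-1` `[k%:R * d, k.+1%:R * d[%classic.
have mE k : measurable (E k) by exact: mw.
have Efin k : (mu (E k) < +oo)%E.
  apply: le_lt_trans Dfin; apply: le_measure;
    [apply/mem_set; exact: mE|exact/mem_set|exact: subIsetl].
have kd0 k : 0 < k.+1%:R * d by rewrite mulr_gt0.
(* With this bound on the measure of [A k], the integral of [v k] is at most e / 2^(k+1), and these
   terms sum to [e]. *)
pose r k := e / (2 ^ k.+1)%:R / (k.+1%:R * d).
have r0 k : 0 < r k by rewrite !divr_gt0// ltr0n expn_gt0.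
have /choice[V HV] k : exists U : set R,
    [/\ open U, E k `<=` U & (mu (U `\` E k) < (r k)%:E)%E].
  exact: lebesgue_regularity_outer.
pose A k := V k `\` E k.
have mA k : measurable (A k).
  by apply: measurableD => //; apply: open_measurable; case: (HV k).
pose v k (x : R) : \bar R := ((k.+1%:R * d)%:E * (\1_(A k) x)%:E)%E.
have v0 k x : (0 <= v k x)%E by rewrite mule_ge0// lee_fin ?(ltW (kd0 k)).
have mv k : measurable_fun D (v k).
  apply: emeasurable_funM => //; apply/measurable_EFinP.
  exact: measurable_indic.
pose u x : \bar R := ((w x + d)%:E + \sum_(k <oo) v k x)%E.
have s0 x : (0 <= \sum_(k <oo) v k x)%E by exact: nneseries_ge0.
have ms : measurable_fun D (fun x => \sum_(k <oo) v k x)%E.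
  exact: ge0_emeasurable_sum.
have mwd : measurable_fun D (fun x => (w x + d)%:E).
  by apply/measurable_EFinP; exact: measurable_funD.
have wd0 x : D x -> (0 <= (w x + d)%:E)%E.
  by move=> Dx; rewrite lee_fin addr_ge0 ?w0// ltW.
exists u; split.
- exact: emeasurable_funD.
- by move=> x Dx; rewrite adde_ge0 ?wd0.
- rewrite ge0_integralD//.
  rewrite integral_nneseries//.
  under eq_integral do rewrite EFinD.
  rewrite ge0_integralD//; last 2 first.
    exact/measurable_EFinP.
    by rewrite lee_fin ltW.
  rewrite -addeA leeD2l// (_ : eps = e + e); last by rewrite -splitr.
  rewrite EFinD leeD//.
    rewrite integral_cst//= -[X in (_ * X <= _)%E]fineK// -EFinM lee_fin -/m.
    by rewrite /d -mulrA ler_piMr ?(ltW e0)// mulrC ler_pdivrMr ?mul1r ?ltr_wpDl// lerDl.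
  apply: le_trans (@epsilon_trick0 R e xpredT (ltW e0)).
  apply: lee_nneseries => [k _ _|k _]; first by apply: integral_ge0 => x _.
  rewrite ge0_integralZl_EFin//; last 2 first.
  + apply/measurable_EFinP. apply: measurable_indic; exact: mA.
  + exact: ltW.
  rewrite integral_indic//; last exact: mA.
  apply: (@le_trans _ _ ((k.+1%:R * d)%:E * (r k)%:E)%E).
    rewrite lee_pmul2l// ?lte_fin ?kd0//.
    apply: (@le_trans _ _ (mu (A k))).
      apply: le_measure;
        [apply/mem_set/measurableI; [exact: mA|exact: mD]|
         apply/mem_set; exact: mA|exact: subIsetl].
    by apply: ltW; case: (HV k).
  by rewrite -EFinM lee_fin mulrC /r divfK// mulf_neq0// gt_eqF.
(* [k] is the index of the layer of height [d] that contains [x]; the constant sought is the upper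
   edge of this layer. *)
- move=> x Dx; pose k := Num.trunc (w x / d).
  have Ek : E k x.
    split => //=; rewrite in_itv/=.
    have := @truncn_itv _ (w x / d); rewrite divr_ge0 ?w0 ?(ltW d0)// => /(_ isT).
    by rewrite ler_pdivlMr// ltr_pdivrMr.
  exists (k.+1%:R * d); first by case: Ek => _ /=; rewrite in_itv/= => /andP[].
  have [oV EV _] := HV k.
  have : nbhs x (V k) by apply: open_nbhs_nbhs; split => //; exact: EV.
  apply: filterS => y Vy Dy.
  have [Ey|nEy] := pselect (E k y).
    apply: (@le_trans _ _ (w y + d)%:E); last by rewrite leeDl.
    case: Ey => _ /=; rewrite in_itv/= => /andP[+ _]; rewrite lee_fin -natr1 mulrDl mul1r.
    by rewrite lerD2r.
  apply: (@le_trans _ _ (v k y)).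
    by rewrite /v indicE mem_set ?mule1//; split.
  apply: (@le_trans _ _ (\sum_(0 <= i < k.+1) v i y)%E).
    by rewrite big_nat_recr//= leeDr// sume_ge0.
  apply: (@le_trans _ _ (\sum_(i <oo) v i y)%E); first exact: nneseries_lim_ge.
  by rewrite leeDr// wd0.
Qed.

(* Only increments inside [a, b] are taken, so the derivative is one-sided at the
   endpoints. *)
Definition deriv_on (R : realType) (a b : R) (G g : R -> R) : Prop :=
  forall x, x \in `[a, b] -> forall e, 0 < e -> \forall y \near x,
    y \in `[a, b] -> `|G y - G x - g x * (y - x)| <= e * `|y - x|.

Lemma deriv_on_continuous (R : realType) (a b : R) (G g : R -> R) :
  deriv_on a b G g -> {within `[a, b], continuous G}.
Proof.
move=> dG; apply/subspace_continuousP => x xab; apply/cvgrPdist_le => e e0.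
have k0 : 0 < 1 + `|g x| by rewrite ltr_pwDl.
rewrite near_withinE; near=> y => yab; rewrite distrC.
have yx : `|y - x| <= e / (1 + `|g x|).
  rewrite distrC; near: y.
  by apply: cvgr_dist_le => //; rewrite divr_gt0.
rewrite -(subrK (g x * (y - x)) (G y - G x)) (le_trans (ler_normD _ _))// normrM.
rewrite -(divfK (lt0r_neq0 k0) e) -[leRHS]mulrC mulrDl.
rewrite lerD ?ler_wpM2l//; apply: le_trans (_ : 1 * `|y - x| <= _).
  by move: yab; near: y; apply: dG.
by rewrite ler_wpM2l.
Unshelve. all: by end_near. Qed.

(** Let [u] be a lower semicontinuous majorant of [w]. Just to the right of [x], [u] is at least
    some c > w x >= g x, so the increments of [G] are at most c (y - x), hence at most the integral
    of [u]. The excess of that integral over the one of [w] is arbitrarily small. *)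
Lemma ge0_deriv_le_integral (R : realType) (a b : R) (G g w : R -> R)
    (ab : a <= b) (dG : deriv_on a b G g) (mw : measurable_fun `[a, b] w)
    (w0 : forall x, x \in `[a, b] -> 0 <= w x)
    (gw : forall x, x \in `[a, b] -> g x <= w x) :
  ((G b - G a)%:E <= \int[@lebesgue_measure R]_(z in `[a, b]) (w z)%:E)%E.
Proof.
apply/lee_addgt0Pr => e e0.
have mufin : (@lebesgue_measure R `[a, b]%classic < +oo)%E.
  by rewrite lebesgue_measure_itv/=; case: ifP => //; rewrite -EFinB ltry.
have [//|u [mu_ u0 ule ulsc]] := lsc_majorant _ mufin mw w0 e0.
apply: le_trans ule.
apply: ge0_increment_le_integral => //; first exact: deriv_on_continuous dG.
move=> x; rewrite in_itv/= => /andP[ax xb].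
have xab : x \in `[a, b] by rewrite in_itv/= ax ltW.
have [c wc /nbhs_ballP[r /= r0 uc]] := ulsc x xab.
have cw0 : 0 < c - w x by rewrite subr_gt0.
have c0 : 0 <= c by rewrite (le_trans (w0 x xab))// ltW.
near=> y.
have xy : x < y by [].
have yb : y <= b by near: y; exact: nbhs_right_le.
have yxr : y < x + r by near: y; apply: nbhs_right_lt; rewrite ltrDl.
have ayb : y \in `[a, b] by rewrite in_itv/= yb (le_trans ax)// ltW.
have sub : `]x, y]%classic `<=` `[a, b]%classic.
  move=> z/=; rewrite !in_itv/= => /andP[xz zy].
  by rewrite (le_trans ax (ltW xz)) (le_trans zy yb).
apply: (@le_trans _ _ (\int[@lebesgue_measure R]_(z in `]x, y]) (cst c z)%:E)%E).
  rewrite /= integral_cst//= lebesgue_measure_itv/= lte_fin xy -EFinD -EFinM lee_fin.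
  (* The gap [c - w x] is the error allowed in the linear approximation of [G] at [x]. *)
  have Gy : `|G y - G x - g x * (y - x)| <= (c - w x) * `|y - x|.
    move: ayb; near: y; apply: cvg_within; exact: dG.
  move/(le_trans (ler_norm _)) : Gy.
  rewrite gtr0_norm ?subr_gt0// lerBlDr => /le_trans; apply.
  by rewrite -mulrDl ler_wpM2r ?subr_ge0 ?(ltW xy)// -addrA gerDl addrC subr_le0 gw.
apply: ge0_le_integral => //=.
- exact: measurable_funS mu_.
- move=> z zxy; apply: uc (sub _ zxy) => /=; move: zxy; rewrite in_itv/= => /andP[xz zy].
  by rewrite /ball/= distrC ger0_norm ?subr_ge0 ?(ltW xz)// ltrBlDl (le_lt_trans zy).
Unshelve. all: by end_near. Qed.

(** The truncations [t n] of [g] from below at -n satisfy the bound, and they converge to [g] with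
    |g| as a dominating function. *)
Lemma deriv_le_integral (R : realType) (a b : R) (G g : R -> R)
    (ab : a <= b) (dG : deriv_on a b G g)
    (ig : (@lebesgue_measure R).-integrable `[a, b] (EFin \o g)) :
  ((G b - G a)%:E <= \int[@lebesgue_measure R]_(z in `[a, b]) (g z)%:E)%E.
Proof.
pose mu := @lebesgue_measure R.
have muab : mu `[a, b]%classic = (b - a)%:E.
  rewrite /mu lebesgue_measure_itv/= lte_fin; case: ltP => [//|ba].
  by rewrite (@le_anti _ _ a b) ?ab// subrr.
have mufin : (mu `[a, b]%classic < +oo)%E by rewrite muab ltry.
have mg : measurable_fun `[a, b] g by apply/measurable_EFinP; exact: measurable_int ig.
pose t n x := Num.max (g x) (- n%:R).
have mt n : measurable_fun `[a, b] (t n) by exact: measurable_maxr.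
have tg n x : `|t n x| <= `|g x|.
  rewrite /t; have [gn|//] := leP (g x) (- n%:R); rewrite normrN normr_nat.
  by rewrite ler0_norm ?(le_trans gn) ?oppr_le0// lerNr.
have it n : mu.-integrable `[a, b] (EFin \o t n).
  apply: le_integrable ig => //; first by apply/measurable_EFinP; exact: mt.
  by move=> x _ /=; rewrite lee_fin; exact: tg.
(* Adding n x to [G] shifts the derivative by n, which makes [t n + n] nonnegative; the two
   contributions n (b - a) then cancel. *)
have Gt n : ((G b - G a)%:E <= \int[mu]_(x in `[a, b]) (t n x)%:E)%E.
  have : (((G b + n%:R * b) - (G a + n%:R * a))%:E <=
          \int[mu]_(x in `[a, b]) (t n x + n%:R)%:E)%E.
    apply: (@ge0_deriv_le_integral _ a b (fun x => G x + n%:R * x)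
      (fun x => g x + n%:R)) => //.
    - move=> x xab e e0; near=> y => yab.
      rewrite (_ : _ - _ - _ = G y - G x - g x * (y - x)); last by ring.
      by move: yab; near: y; exact: dG.
    - exact: measurable_funD.
    - by move=> x _; rewrite -lerBlDr sub0r /t le_max lexx orbT.
    - by move=> x _; rewrite lerD2r /t le_max lexx.
  under eq_integral do rewrite EFinD.
  rewrite integralD_EFin//=; last first.
    apply: measurable_bounded_integrable => //=.
    exact: bounded_cst.
  rewrite integral_cst//= [X in (_ * X)%E](_ : _ = (b - a)%:E); last exact: muab.
  rewrite (_ : _ - _ = G b - G a + n%:R * (b - a)); last by ring.
  by rewrite -EFinM [in X in (X <= _)%E]EFinD leeD2rE.
have [||_ _] := @dominated_convergence _ _ _ mu `[a, b] (measurable_itv _)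
    (fun n => EFin \o t n) (EFin \o g) (abse \o (EFin \o g))
    (fun n => (measurable_EFinP _ _).2 (mt n)) ((measurable_EFinP _ _).2 mg) _
    (integrable_abse ig) _.
- apply: aeW => x xab; apply: cvg_near_cst.
  (* At a fixed [x] the truncation is inactive as soon as n >= - g x. *)
  near=> n; rewrite /= /t; congr EFin; apply/max_idPl.
  by rewrite lerNl; near: n; exact: nbhs_infty_ger.
- by apply: aeW => x n xab; rewrite /= lee_fin.
- by apply: cvge_ge; apply: nearW => n; exact: Gt.
Unshelve. all: by end_near. Qed.

(** The one-sided bound is applied to [G] and to [- G]. *)
Lemma integral_deriv_on (R : realType) (a b : R) (G g : R -> R)
    (ab : a <= b) (dG : deriv_on a b G g)
    (ig : (@lebesgue_measure R).-integrable `[a, b] (EFin \o g)) :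
  \int[@lebesgue_measure R]_(z in `[a, b]) g z = G b - G a.
Proof.
have dNG : deriv_on a b (fun x => - G x) (fun x => - g x).
  move=> x xab e e0; near=> y => yab.
  rewrite (_ : _ - _ - _ = - (G y - G x - g x * (y - x))); last by ring.
  by rewrite normrN; move: yab; near: y; exact: dG.
have iNg : (@lebesgue_measure R).-integrable `[a, b] (EFin \o (fun x => - g x)).
  by have := integrableN ig; apply: eq_integrable.
have gfin : (\int[@lebesgue_measure R]_(z in `[a, b]) (g z)%:E)%E \is a fin_num.
  exact: integrable_fin_num ig.
have := deriv_le_integral ab dG ig.
have := deriv_le_integral ab dNG iNg.
under eq_integral do rewrite EFinN.
rewrite integralN/=; last first.
  exact: integrable_add_def ig.
rewrite /Rintegral -(fineK gfin) -EFinN !lee_fin => h1 h2.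
by apply/le_anti; rewrite h2 andbT -lerN2 opprD.
Unshelve. all: by end_near. Qed.

(** * Derivatives within an interval: link with the definitions, products, measurability *)

Lemma derivable_within_deriv_on (R : realType) (D : set R) (a b : R)
    (f : R -> R) (abD : `[a, b]%classic `<=` D)
    (df : forall x, x \in `[a, b] -> derivable_within D f x) :
  deriv_on a b f (derive_within D f).
Proof.
move=> x xab e e0; have /cvgrPdist_le/(_ e e0) := df x xab.
rewrite near_withinE near_withinE; apply: filterS => y Hy yab.
have [->|yx] := eqVneq y x; first by rewrite !subrr mulr0 subr0 normr0 mulr0.
have := Hy yx (abD _ yab); rewrite -/(derive_within D f x) distrC => {}Hy.
have yx0 : y - x != 0 by rewrite subr_eq0.
rewrite -(divfK yx0 (f y - f x)) -mulrBl normrM.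
by rewrite ler_wpM2r.
Qed.

Lemma deriv_onM (R : realType) (a b : R) (F G f g : R -> R) :
  deriv_on a b F f -> deriv_on a b G g ->
  deriv_on a b (fun x => F x * G x) (fun x => f x * G x + F x * g x).
Proof.
move=> dF dG x xab e e0.
have /subspace_continuousP/(_ x xab)/cvgrPdist_le cF := deriv_on_continuous dF.
pose e3 := e / 3.
have e30 : 0 < e3 by rewrite divr_gt0.
(* The error is shared among three terms. The added 1 keeps the divisors positive, and [k2] also
   bounds |F y| once |F x - F y| <= 1. *)
pose k1 := 1 + `|G x|; pose k2 := 1 + `|F x|; pose k3 := 1 + `|g x|.
have k10 : 0 < k1 by rewrite ltr_pwDl.
have k20 : 0 < k2 by rewrite ltr_pwDl.
have k30 : 0 < k3 by rewrite ltr_pwDl.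
have H1 := dF x xab (e3 / k1) (divr_gt0 e30 k10).
have H2 := dG x xab (e3 / k2) (divr_gt0 e30 k20).
have := cF _ (divr_gt0 e30 k30); rewrite near_withinE => H3.
have := cF _ ltr01; rewrite near_withinE => H4.
near=> y => yab.
have E1 : `|F y - F x - f x * (y - x)| <= e3 / k1 * `|y - x|.
  by move: yab; near: y; exact: H1.
have E2 : `|G y - G x - g x * (y - x)| <= e3 / k2 * `|y - x|.
  by move: yab; near: y; exact: H2.
have E3 : `|F x - F y| <= e3 / k3 by move: yab; near: y; exact: H3.
have E4 : `|F x - F y| <= 1 by move: yab; near: y; exact: H4.
rewrite (_ : F y * G y - _ - _ = (F y - F x - f x * (y - x)) * G x
   + F y * (G y - G x - g x * (y - x)) + (F y - F x) * g x * (y - x)); last by ring.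
have -> : e * `|y - x| = e3 * `|y - x| + e3 * `|y - x| + e3 * `|y - x|.
  by rewrite /e3; field.
have fr (k z d : R) : 0 < k -> 0 <= z -> 0 <= d -> z <= k -> e3 / k * d * z <= e3 * d.
  move=> k0 z0 d0 zk; rewrite mulrAC ler_wpM2r// -mulrA ger_pMr// mulrC.
  by rewrite ler_pdivrMr// mul1r.
rewrite (le_trans (ler_normD _ _))//; apply: lerD.
  rewrite (le_trans (ler_normD _ _))//; apply: lerD; rewrite normrM.
    by apply: (le_trans (ler_wpM2r _ E1)) => //; rewrite fr// /k1 lerDr.
  rewrite mulrC; apply: (le_trans (ler_wpM2r _ E2)) => //; rewrite fr//.
  rewrite -(subrK (F x) (F y)) (le_trans (ler_normD _ _))// lerD2r distrC.
  exact: E4.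
rewrite 2!normrM distrC mulrAC.
apply: le_trans (_ : e3 / k3 * `|y - x| * `|g x| <= _); first by rewrite !ler_wpM2r.
by rewrite fr// /k3 lerDr.
Unshelve. all: by end_near. Qed.

(** On [a, b[ the derivative is the pointwise limit of n+1 times the increment of [G] over a step of
    length 1/(n+1) to the right. The step is cut off at [b] to stay in the interval, which changes
    nothing for large n; the single point [b] does not affect measurability. *)
Lemma measurable_deriv_on (R : realType) (a b : R) (G g : R -> R) :
  deriv_on a b G g -> measurable_fun `[a, b] g.
Proof.
move=> dG; apply/measurable_fun_itv_bndo_bndcP.
have mG : measurable_fun `[a, b] G.
  by apply: subspace_continuous_measurable_fun => //; exact: deriv_on_continuous dG.
pose s n x : R := Num.min (x + n.+1%:R^-1) b.
have sub : `[a, b[%classic `<=` `[a, b]%classic by apply: subset_itvl; rewrite bnd_simp.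
have sab n x : `[a, b[%classic x -> `[a, b]%classic (s n x).
  rewrite /= !in_itv/= => /andP[ax xb]; rewrite /s ge_min lexx orbT andbT le_min.
  by rewrite (le_trans ax (ltW xb)) andbT ler_wpDr.
apply: (@measurable_fun_cvg _ _ R _ (fun n x => n.+1%:R * (G (s n x) - G x))).
  move=> n; apply: measurable_funM => //; apply: measurable_funB.
    apply: (measurable_comp (F := `[a, b]%classic)) => //.
      by move=> _ [x xab <-]; exact: sab.
    by apply: measurable_minr => //; exact: measurable_funD.
  exact: measurable_funS mG.
move=> x xab; apply/cvgrPdist_le => e e0.
have /nbhs_ballP[r /= r0 Hr] := dG x (sub _ xab) e e0.
move: (xab); rewrite /= in_itv/= => /andP[ax xb].
have bx0 : 0 < b - x by rewrite subr_gt0.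
near=> n.
have nr : n.+1%:R^-1 < r by near: n; exact: (near_infty_natSinv_lt (PosNum r0)).
have nb : n.+1%:R^-1 < b - x.
  by near: n; exact: (near_infty_natSinv_lt (PosNum bx0)).
have sE : s n x = x + n.+1%:R^-1.
  by apply/min_idPl; rewrite -lerBrDl ltW.
have n0 : 0 < n.+1%:R^-1 :> R by rewrite invr_gt0.
have : `|G (s n x) - G x - g x * (s n x - x)| <= e * `|s n x - x|.
  apply: Hr; last exact: sab.
  by rewrite /ball/= sE opprD addNKr normrN gtr0_norm.
rewrite {2 3}sE (_ : x + n.+1%:R^-1 - x = n.+1%:R^-1); last by ring.
rewrite (gtr0_norm n0) -ler_pdivrMr// -{2}(gtr0_norm n0) -normf_div distrC.
by rewrite mulrBl mulfK ?gt_eqF// invrK mulrC.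
Unshelve. all: by end_near. Qed.

(** * A weighted Hoelder inequality and the continuity of real powers *)

(** Hoelder's inequality for the factorization w g = w^(1 - 1/q) (w^(1/q) g), with the conjugate
    exponents 1 / (1 - 1/q) and q. *)
Lemma weighted_hoelder d (T : measurableType d) (R : realType)
    (mu : {measure set T -> \bar R}) (D : set T) (w g : T -> R) (q : R)
    (mD : measurable D) (q1 : 1 < q)
    (mw : measurable_fun D w) (mg : measurable_fun D g)
    (w0 : forall x, D x -> 0 <= w x) (g0 : forall x, D x -> 0 <= g x)
    (iw : mu.-integrable D (EFin \o w))
    (iwg : mu.-integrable D (EFin \o (fun x => w x * g x `^ q))) :
  \int[mu]_(x in D) (w x * g x) <=
  (\int[mu]_(x in D) w x) `^ (1 - q^-1) *
  (\int[mu]_(x in D) (w x * g x `^ q)) `^ q^-1.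
Proof.
have q0 : 0 < q by exact: lt_trans q1.
pose r := 1 - q^-1.
have r0 : 0 < r by rewrite subr_gt0 invf_lt1.
pose F := (fun x => w x `^ r) \_ D.
pose G := (fun x => w x `^ q^-1 * g x) \_ D.
have mF : measurable_fun setT F.
  apply/(measurable_restrictT _ mD).
  by apply: (measurableT_comp (@measurable_powR R r)).
have mG : measurable_fun setT G.
  apply/(measurable_restrictT _ mD); apply: measurable_funM => //.
  by apply: (measurableT_comp (@measurable_powR R q^-1)).
have rq : r^-1^-1 + q^-1 = 1 by rewrite invrK subrK.
have r'0 : 0 < r^-1 by rewrite invr_gt0.
have := hoelder mu mF mG r'0 q0 rq.
have E (k : T -> R) (H : T -> \bar R) : mu.-integrable D (EFin \o k) ->
    (forall x, H x = ((k \_ D) x)%:E) ->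
    (\int[mu]_x H x = (\int[mu]_(x in D) k x)%:E)%E.
  move=> ik HE; rewrite /Rintegral fineK; last exact: integrable_fin_num ik.
  by rewrite [RHS]integral_mkcond; apply: eq_integral => x _; rewrite HE restrict_EFin.
(* w g is dominated by w + w g^q: by the first term where g <= 1, by the second elsewhere. *)
have iprod : mu.-integrable D (EFin \o (fun x => w x * g x)).
  apply: (le_integrable mD _ _ (integrableD mD iw iwg)).
    by apply/measurable_EFinP; exact: measurable_funM.
  move=> x Dx /=; rewrite lee_fin !ger0_norm ?addr_ge0 ?mulr_ge0 ?powR_ge0 ?w0 ?g0//.
  have [g1|g1] := leP (g x) 1.
    rewrite (@le_trans _ _ (w x))// ?lerDl ?mulr_ge0 ?powR_ge0 ?w0//.
    by rewrite ler_piMr ?w0.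
  rewrite (@le_trans _ _ (w x * g x `^ q))// ?lerDr ?w0//.
  by rewrite ler_wpM2l ?w0// le1r_powR// ltW.
rewrite Lnorm1 unlock.
rewrite (E _ _ iprod); last first.
  move=> x; rewrite /= /F /G /patch; case: ifPn => [|_]; last by rewrite mulr0 normr0.
  (* The two exponents add up to 1, which is nonzero, so the powers of [w x] combine even where [w]
     vanishes. *)
  rewrite inE => Dx; rewrite mulrA -powRD; last by rewrite subrK oner_eq0.
  by rewrite subrK powRr1 ?w0// ger0_norm// mulr_ge0 ?w0 ?g0.
rewrite (E _ _ iw); last first.
  move=> x; rewrite /= /F /patch; case: ifPn => [|_]; last first.
    by rewrite normr0 powR0// gt_eqF.
  rewrite inE => Dx.
  by rewrite ger0_norm ?powR_ge0// -powRrM mulfV ?gt_eqF// powRr1// w0.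
rewrite (E _ _ iwg); last first.
  move=> x; rewrite /= /G /patch; case: ifPn => [|_]; last first.
    by rewrite normr0 powR0// gt_eqF.
  rewrite inE => Dx.
  rewrite ger0_norm ?mulr_ge0 ?powR_ge0 ?g0// powRM ?powR_ge0 ?g0//.
  by rewrite -powRrM mulVf ?gt_eqF// powRr1// w0.
by rewrite !poweR_EFin -EFinM lee_fin invrK.
Qed.

Lemma within_continuous_powR (R : realType) (p : R) : 0 < p ->
  {within `[0, +oo[, continuous (fun x : R => x `^ p)}.
Proof.
move=> p0; apply/continuous_within_itvcyP; split.
  move=> x x0; apply: differentiable_continuous; apply/derivable1_diffP.
  exact: derivable_powR.
by rewrite powR0 ?gt_eqF//; exact: powR_cvg0.
Qed.

Lemma within_continuous_powR_comp (R : realType) (D : set R) (v : R -> R) (p : R) :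
  0 < p -> {within D, continuous v} -> (forall x, D x -> 0 <= v x) ->
  {within D, continuous (fun x => v x `^ p)}.
Proof.
move=> p0 /subspace_continuousP cv v0; apply/subspace_continuousP => x Dx.
have /subspace_continuousP/(_ (v x)) := within_continuous_powR p0.
rewrite /= in_itv/= v0// => /(_ isT)/cvgrPdist_le cP.
apply/cvgrPdist_le => e e0; have := cP e e0; rewrite near_withinE => {}cP.
have := cv x Dx _ cP; rewrite /nbhs/=/within/=; apply: filterS => y H Dy.
by apply: H => //=; rewrite in_itv/= v0.
Qed.

(** * Harmonic interpolation and the corresponding change of variables *)

(* [Lpt a b] is [harm_itp a (Hmean a b)] and [Upt a b] is
   [harm_itp b (Hmean a b)]; it runs from [d] at 0 to [c] at 1. *)
Definition harm_itp (R : realType) (c d t : R) : R := c * d / (t * d + (1 - t) * c).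

Section harmonic_interpolation.
Context (R : realType) (c d : R).
Hypotheses (cd0 : 0 < c * d).
Let S := harm_itp c d.
Let k := (d - c) / (c * d).

(** Multiplied by [c], the denominator becomes t c d + (1 - t) c^2, which is positive whatever the
    common sign of [c] and [d]. *)
Let den_gt0 (t : R) : 0 <= t <= 1 -> 0 < c * (t * d + (1 - t) * c).
Proof.
move=> /andP[t0 t1]; rewrite mulrDr mulrCA [c * (_ * c)]mulrCA.
have c0 : c != 0 by apply: contraTneq cd0 => ->; rewrite mul0r ltxx.
have [->|tn0] := eqVneq t 0; last first.
  apply: ltr_pwDl; first by rewrite mulr_gt0// lt_neqAle eq_sym tn0.
  by rewrite mulr_ge0 ?subr_ge0// -expr2 sqr_ge0.
by rewrite mul0r add0r subr0 mul1r -expr2 exprn_even_gt0.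
Qed.

Lemma harm_itp_den_neq0 (t : R) : 0 <= t <= 1 -> t * d + (1 - t) * c != 0.
Proof. by move=> /den_gt0; apply: contraTneq => ->; rewrite mulr0 ltxx. Qed.

(** 1 / S(t) = t / c + (1 - t) / d is affine in t with slope k, so - S' / S^2 = k. *)
Lemma is_derive_harm_itp (t : R) : 0 <= t <= 1 ->
  is_derive t 1 S (- k * S t ^+ 2).
Proof.
move=> /harm_itp_den_neq0 dn0.
have c0 : c != 0 by apply: contraTneq cd0 => ->; rewrite mul0r ltxx.
have d0 : d != 0 by apply: contraTneq cd0 => ->; rewrite mulr0 ltxx.
have H : is_derive t 1 (fun t => t * d + (1 - t) * c) (d - c).
  have H1 : is_derive t 1 (fun t : R => (d - c) * t + c) ((d - c) *: (1 : R) + 0).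
    exact: is_deriveD.
  rewrite (_ : (fun _ => _) = (fun t => (d - c) * t + c)); last by apply/funext => s; ring.
  by apply: is_derive_eq; rewrite addr0 scaler1.
have H2 := @is_deriveV _ (fun t => t * d + (1 - t) * c) _ _ _ dn0 H.
have H3 := @is_deriveZ _ _ _ _ (c * d) _ _ _ H2.
apply: is_derive_eq.
rewrite /k /S /harm_itp /GRing.scale/=; field.
by rewrite ?dn0 ?c0 ?d0.
Qed.

Lemma harm_itp0 : S 0 = d.
Proof.
rewrite /S /harm_itp mul0r add0r subr0 mul1r mulrAC mulfV ?mul1r//.
by apply: contraTneq cd0 => ->; rewrite mul0r ltxx.
Qed.

Lemma harm_itp1 : S 1 = c.
Proof.
rewrite /S /harm_itp subrr mul0r addr0 mul1r mulfK//.
by apply: contraTneq cd0 => ->; rewrite mulr0 ltxx.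
Qed.

(** The sign of [d - c] decides the direction in which [S] is monotone; this form serves both
    directions, and the range of [S] as well. *)
Lemma harm_itpB (s t : R) : 0 <= s <= 1 -> 0 <= t <= 1 ->
  exists2 m, 0 < m & S s - S t = m * ((d - c) * (t - s)).
Proof.
move=> s01 t01; exists (c * d / ((s * d + (1 - s) * c) * (t * d + (1 - t) * c))).
  (* Both denominators have the sign of [c]. A positive factor is inserted so that each of them
     appears multiplied by [c]. *)
  rewrite divr_gt0// -(pmulr_rgt0 _ (mulr_gt0 (den_gt0 s01) (den_gt0 s01))).
  rewrite [ltRHS](_ : _ = (s * d + (1 - s) * c) ^+ 2 *
     (c * (s * d + (1 - s) * c) * (c * (t * d + (1 - t) * c)))); last by ring.
  apply: mulr_gt0; last by rewrite mulr_gt0 ?den_gt0.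
  by rewrite exprn_even_gt0//= harm_itp_den_neq0.
rewrite /S /harm_itp; field.
by rewrite !harm_itp_den_neq0.
Qed.

Lemma continuous_harm_itp (t : R) : 0 <= t <= 1 -> {for t, continuous S}.
Proof.
move=> /is_derive_harm_itp H; apply: differentiable_continuous.
by apply/derivable1_diffP; exact: ex_derive.
Qed.

Let dS (t : R) : 0 <= t <= 1 -> derive1 S t = - k * S t ^+ 2.
Proof.
by move=> /is_derive_harm_itp H; rewrite derive1E derive_val.
Qed.

Let cdS (t : R) : 0 <= t <= 1 -> - k * S x ^+ 2 @[x --> t] --> - k * S t ^+ 2.
Proof.
move=> /continuous_harm_itp cS; apply: cvgM; first exact: cvg_cst.
by rewrite expr2; apply: cvgM; exact: cS.
Qed.

(** The formula for [derive1 S] is established on [0, 1] only, so continuity inside and the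
    one-sided limits at 0 and 1 are transferred from the formula by equality near the point. *)
Let dS_oo : {in `]0, 1[, continuous (derive1 S)}.
Proof.
move=> t t01; move: (t01); rewrite in_itv/= => /andP[t0 t1].
have t01' : 0 <= t <= 1 by rewrite !ltW.
rewrite /continuous_at dS//; apply: cvg_trans (cdS t01').
apply: near_eq_cvg; near=> x.
have : x \in `]0, 1[ by near: x; exact: near_in_itvoo.
by rewrite in_itv/= => /andP[x0 x1]; rewrite dS// !ltW.
Unshelve. all: by end_near. Qed.

Let dS0 : cvg (derive1 S x @[x --> 0^'+]).
Proof.
apply: (cvgP (- k * S 0 ^+ 2)).
apply: cvg_trans (cvg_at_right_filter (@cdS 0 _)); last by rewrite lexx ler01.
apply: near_eq_cvg; near=> x; rewrite dS//; apply/andP; split => //.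
by near: x; exact: nbhs_right_le.
Unshelve. all: by end_near. Qed.

Let dS1 : cvg (derive1 S x @[x --> 1^'-]).
Proof.
apply: (cvgP (- k * S 1 ^+ 2)).
apply: cvg_trans (cvg_at_left_filter (@cdS 1 _)); last by rewrite lexx ler01.
apply: near_eq_cvg; near=> x; rewrite dS//; apply/andP; split => //.
by near: x; exact: nbhs_left_ge.
Unshelve. all: by end_near. Qed.

Let doS : derivable_oo_LRcontinuous S 0 1.
Proof.
split.
- move=> t; rewrite in_itv/= => /andP[t0 t1].
  have t01 : 0 <= t <= 1 by rewrite (ltW t0) ltW.
  by have H := is_derive_harm_itp t01; exact: ex_derive.
- by apply: cvg_at_right_filter; apply: continuous_harm_itp; rewrite lexx ler01.
- by apply: cvg_at_left_filter; apply: continuous_harm_itp; rewrite lexx ler01.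
Qed.

Lemma Rintegral_harm_itp_decreasing (G : R -> R) : c < d ->
  {within `[c, d], continuous G} ->
  \int[@lebesgue_measure R]_(x in `[c, d]) G x =
  \int[@lebesgue_measure R]_(t in `[0, 1]) (G (S t) * (k * S t ^+ 2)).
Proof.
move=> cd cG; rewrite /Rintegral -harm_itp0 -{1}harm_itp1.
rewrite (integration_by_substitution_decreasing _ _ dS_oo dS0 dS1 doS).
- congr fine; apply: eq_integral => t; rewrite inE/= in_itv/= => t01.
  have -> : ((G \o S) * - derive1 S) t = G (S t) * - derive1 S t by [].
  by rewrite dS// mulNr opprK.
- exact: ler01.
- move=> s t; rewrite !in_itv/= => s01 t01 st.
  have [m m0 E] := harm_itpB t01 s01.
  by rewrite -subr_gt0 E !pmulr_rgt0 ?subr_gt0.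
- by rewrite harm_itp0 harm_itp1.
Qed.

Lemma Rintegral_harm_itp_increasing (G : R -> R) : d < c ->
  {within `[d, c], continuous G} ->
  \int[@lebesgue_measure R]_(x in `[d, c]) G x =
  \int[@lebesgue_measure R]_(t in `[0, 1]) (G (S t) * (- k * S t ^+ 2)).
Proof.
move=> dc cG; rewrite /Rintegral -{1}harm_itp0 -harm_itp1.
rewrite (integration_by_substitution_increasing _ _ dS_oo dS0 dS1 doS).
- congr fine; apply: eq_integral => t; rewrite inE/= in_itv/= => t01.
  have -> : ((G \o S) * derive1 S) t = G (S t) * derive1 S t by [].
  by rewrite dS.
- exact: ler01.
- move=> s t; rewrite !in_itv/= => s01 t01 st.
  have [m m0 E] := harm_itpB t01 s01.
  by rewrite -subr_gt0 E pmulr_rgt0// nmulr_rgt0 ?subr_lt0.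
- by rewrite harm_itp0 harm_itp1.
Qed.
End harmonic_interpolation.

(** * The weighted estimate between two points of the same sign *)

Lemma within_continuousM (R : realType) (A : set R) (f g : R -> R) :
  {within A, continuous f} -> {within A, continuous g} ->
  {within A, continuous (fun x => f x * g x)}.
Proof. by move=> cf cg x; exact: (@continuousM R (subspace A) f g x (cf x) (cg x)). Qed.

(** The product form is symmetric in [c] and [d], so membership can be treated without knowing which
    one is smaller. *)
Lemma in_itv_minmax (R : realDomainType) (c d x : R) :
  (x \in `[Num.min c d, Num.max c d]) = (0 <= (x - c) * (d - x)).
Proof.
rewrite in_itv/=; apply/idP/idP.
  by have [cd|cd] := leP c d => /andP[? ?]; nra.
by have [cd|cd] := leP c d => H; apply/andP; split; rewrite leNgt; apply/negP => ?; nra.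
Qed.

Section harmonic_interpolation_bound.
Context (R : realType) (c d : R).
Hypotheses (cd0 : 0 < c * d) (cd : c != d).
Let S := harm_itp c d.
Let J := `[Num.min c d, Num.max c d].
Let k := `|d - c| / (c * d).

Lemma harm_itp_in (t : R) : t \in `[0, 1] -> S t \in J.
Proof.
rewrite in_itv/= => t01; rewrite in_itv_minmax.
have h01 : 0 <= (0 : R) <= 1 by rewrite lexx ler01.
have h11 : 0 <= (1 : R) <= 1 by rewrite lexx ler01.
have [m m0 E] := harm_itpB cd0 t01 h11.
have [n n0 F] := harm_itpB cd0 h01 t01.
rewrite -/S in E F.
rewrite -{1}(harm_itp1 cd0) -{2}(harm_itp0 cd0) E F.
move/andP : t01 => [t0 t1].
rewrite [leRHS](_ : _ = (m * n) * (d - c) ^+ 2 * ((1 - t) * (t - 0))); last by ring.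
rewrite subr0; apply: mulr_ge0; last by rewrite mulr_ge0 ?subr_ge0.
by apply: mulr_ge0 (sqr_ge0 _); rewrite mulr_ge0// ltW.
Qed.

Lemma Rintegral_harm_itp (G : R -> R) : {within [set` J], continuous G} ->
  \int[@lebesgue_measure R]_(x in [set` J]) G x =
  \int[@lebesgue_measure R]_(t in `[0, 1]) (G (S t) * (k * S t ^+ 2)).
Proof.
rewrite /J /k; have [cd'|dc|E] := ltgtP c d; last by move: cd; rewrite E eqxx.
- by rewrite gtr0_norm ?subr_gt0//; exact: Rintegral_harm_itp_decreasing.
- by rewrite ltr0_norm ?subr_lt0// mulNr; exact: Rintegral_harm_itp_increasing.
Qed.

(** The inverse of [S] on [J], found by solving 1 / x = t / c + (1 - t) / d for t. *)
Let tau (x : R) := c * (d - x) / (x * (d - c)).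

(** The interval between [c] and [d] stays on one side of 0. *)
Let Jcx x : x \in J -> 0 < c * x.
Proof.
have cc : 0 < c * c.
  by rewrite -expr2 exprn_even_gt0//=; apply: contraTneq cd0 => ->; rewrite mul0r ltxx.
rewrite in_itv/= => /andP[]; have [cd'|dc] := leP c d => h1 h2.
  have [c0|/ltW c0] := leP 0 c; first exact: lt_le_trans cc (ler_wpM2l c0 h1).
  exact: lt_le_trans cd0 (ler_wnM2l c0 h2).
have [c0|/ltW c0] := leP 0 c; first exact: lt_le_trans cd0 (ler_wpM2l c0 h1).
exact: lt_le_trans cc (ler_wnM2l c0 h2).
Qed.

Let Jn0 x : x \in J -> x != 0.
Proof. by move/Jcx; apply: contraTneq => ->; rewrite mulr0 ltxx. Qed.

Let dc0 : d - c != 0. Proof. by rewrite subr_eq0 eq_sym. Qed.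

Let harm_itpK x : x \in J -> S (tau x) = x.
Proof.
move=> xJ; have x0 := Jn0 xJ; rewrite /S /harm_itp.
rewrite (_ : _ + _ = c * d / x); last by rewrite /tau; field; rewrite x0 dc0.
by rewrite invf_div mulrCA mulfV ?mulr1// gt_eqF.
Qed.

Let tau01 x : x \in J -> tau x \in `[0, 1].
Proof.
move=> xJ; have x0 := Jn0 xJ; have cx := Jcx xJ.
have dx : 0 < d * x.
  have : 0 < c ^+ 2 * (d * x).
    by rewrite [ltRHS](_ : _ = (c * d) * (c * x)); [rewrite mulr_gt0|ring].
  rewrite pmulr_rgt0// exprn_even_gt0//=.
  by apply: contraTneq cd0 => ->; rewrite mul0r ltxx.
have P : 0 < (x * (d - c)) ^+ 2 by rewrite exprn_even_gt0//= mulf_neq0.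
move: xJ; rewrite in_itv_minmax => xJ.
rewrite in_itv/= -[tau x <= 1]subr_ge0; apply/andP; split.
  (* Since (d - x)^2 + (x - c) (d - x) = (d - x) (d - c), the fraction can be written with a square
     as denominator and visibly nonnegative factors above it. *)
  rewrite (_ : tau x = (c * x) * ((d - x) ^+ 2 + (x - c) * (d - x)) / (x * (d - c)) ^+ 2).
    by rewrite divr_ge0 ?(ltW P)// mulr_ge0 ?(ltW cx)// addr_ge0 ?sqr_ge0.
  by rewrite /tau; field; rewrite x0 dc0.
rewrite (_ : 1 - tau x = (d * x) * ((x - c) ^+ 2 + (x - c) * (d - x)) / (x * (d - c)) ^+ 2).
  by rewrite divr_ge0 ?(ltW P)// mulr_ge0 ?(ltW dx)// addr_ge0 ?sqr_ge0.
by rewrite /tau; field; rewrite x0 dc0.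
Qed.

Let tauK t : t \in `[0, 1] -> tau (S t) = t.
Proof.
rewrite in_itv/= => t01; have dn0 := harm_itp_den_neq0 cd0 t01.
rewrite /tau /S /harm_itp; field.
rewrite dc0 dn0/=; apply/andP.
by split; apply: contraTneq cd0 => ->; rewrite ?mul0r ?mulr0 ltxx.
Qed.

Lemma harm_itp_surj x : x \in J -> exists2 t, t \in `[0, 1] & S t = x.
Proof. by move=> xJ; exists (tau x); [exact: tau01|exact: harm_itpK]. Qed.

Let cS : {within `[0, 1], continuous S}.
Proof.
apply: continuous_in_subspaceT => t; rewrite inE/= in_itv/= => t01.
exact: continuous_harm_itp.
Qed.

Let ctau : {within [set` J], continuous tau}.
Proof.
apply: continuous_in_subspaceT => x; rewrite inE/= => xJ.
apply: cvgM.
  by apply: cvgM; [|apply: cvgB]; [exact: cvg_cst|exact: cvg_cst|exact: cvg_id].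
apply: cvgV; first by rewrite mulf_neq0// Jn0.
by apply: cvgM; [exact: cvg_id|exact: cvg_cst].
Qed.

Let within_comp_S (w : R -> R) : {within [set` J], continuous w} ->
  {within `[0, 1], continuous (w \o S)}.
Proof.
move=> /subspace_continuousP cw; apply/subspace_continuousP => t t01.
have St := harm_itp_in t01.
apply/cvgrPdist_le => e e0.
have /cvgrPdist_le/(_ e e0) := cw (S t) St; rewrite near_withinE => H.
have /subspace_continuousP/(_ t t01 _ H) := cS.
rewrite near_withinE /nbhs/=/within/=; apply: filterS => s Hs s01.
by apply: Hs => //; exact: harm_itp_in.
Qed.

Lemma harm_itp_hoelder (q A B : R) (w phi : R -> R) (q1 : 1 < q)
    (A0 : 0 <= A) (B0 : 0 <= B)
    (cw : {within [set` J], continuous w}) (w0 : forall x, x \in J -> 0 <= w x)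
    (iphi : (@lebesgue_measure R).-integrable [set` J] (EFin \o (fun x => w x * `|phi x|)))
    (phi_le : forall t, t \in `[0, 1] -> `|phi (S t)| `^ q <= t * A + (1 - t) * B) :
  \int[@lebesgue_measure R]_(x in [set` J]) (w x * `|phi x|) <=
  k * ((\int[@lebesgue_measure R]_(t in `[0, 1]) w (S t)) `^ (1 - q^-1) *
       (\int[@lebesgue_measure R]_(t in `[0, 1])
          (w (S t) * (t * (S t ^+ 2) `^ q * A + (1 - t) * (S t ^+ 2) `^ q * B)))
         `^ q^-1).
Proof.
have q0 : 0 < q by exact: lt_trans q1.
have qV0 : 0 < q^-1 by rewrite invr_gt0.
pose v t := t * A + (1 - t) * B.
have v0 t : t \in `[0, 1] -> 0 <= v t.
  by rewrite in_itv/= => /andP[t0 t1]; rewrite addr_ge0// mulr_ge0// subr_ge0.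
have cv : continuous v.
  move=> t; apply: cvgD; apply: cvgM; rewrite ?cvg_cst//; try exact: cvg_id.
  exact: cvg_cst.
  apply: cvgB; [exact: cvg_cst|exact: cvg_id].
  exact: cvg_cst.
(* The bound on |phi (S t)|, read as a function of x = S t through t = [tau x]; it is continuous on
   [J], as the substitution requires. *)
pose M x := v (tau x) `^ q^-1.
have cM : {within [set` J], continuous M}.
  apply: within_continuous_powR_comp => //.
    have /subspace_continuousP ct := ctau.
    apply/subspace_continuousP => x xJ; exact: (cvg_comp _ _ (ct x xJ) (cv (tau x))).
  by move=> x /= xJ; apply: v0; exact: tau01.
have phiM x : x \in J -> `|phi x| <= M x.
  move=> xJ; have := phi_le _ (tau01 xJ); rewrite harm_itpK// => H.
  have qn0 : q != 0 by rewrite gt_eqF.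
  rewrite -[leLHS](powRr1 (normr_ge0 _)) -(mulfV qn0) powRrM.
  by rewrite ge0_ler_powR// ?nnegrE ?powR_ge0// ?v0 ?tau01// ltW.
have integ (x y : R) (h : R -> R) : {within `[x, y], continuous h} ->
    (@lebesgue_measure R).-integrable `[x, y] (EFin \o h).
  by apply: continuous_compact_integrable; exact: segment_compact.
have cwM : {within [set` J], continuous (fun x => w x * M x)}.
  exact: within_continuousM cw cM.
have : \int[@lebesgue_measure R]_(x in [set` J]) (w x * `|phi x|) <=
       \int[@lebesgue_measure R]_(x in [set` J]) (w x * M x).
  apply: le_Rintegral => //; first exact: integ.
  by move=> x xJ; rewrite ler_wpM2l ?w0// phiM.
move=> /le_trans; apply; rewrite Rintegral_harm_itp//.
have cS2 : {within `[0, 1], continuous (fun t => S t * S t)}.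
  exact: within_continuousM cS cS.
(* The Jacobian factor S^2 joins the function raised to the power q, whence (S^2)^q in the bound;
   the weight remains w o S. *)
pose g t := S t ^+ 2 * v t `^ q^-1.
have cvq : {within `[0, 1], continuous (fun t => v t `^ q^-1)}.
  by apply: within_continuous_powR_comp => //; exact: continuous_subspaceT.
have cg : {within `[0, 1], continuous g} by exact: within_continuousM cS2 cvq.
have cwS := within_comp_S cw.
have cwg : {within `[0, 1], continuous (fun t => w (S t) * g t)}.
  exact: within_continuousM cwS cg.
have gq t : t \in `[0, 1] -> g t `^ q = (S t ^+ 2) `^ q * v t.
  move=> t01; rewrite /g powRM ?sqr_ge0 ?powR_ge0//.
  by rewrite -powRrM mulVf ?gt_eqF// powRr1// v0.
have cwgq : {within `[0, 1], continuous (fun t => w (S t) * g t `^ q)}.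
  apply: (within_continuousM cwS).
  apply: within_continuous_powR_comp => // t _.
  by rewrite mulr_ge0 ?sqr_ge0 ?powR_ge0.
have Ering (x y z u : R) : x * y * (z * u) = z * (x * (u * y)) by ring.
have -> : \int[@lebesgue_measure R]_(t in `[0, 1]) (w (S t) * M (S t) * (k * S t ^+ 2)) =
    \int[@lebesgue_measure R]_(t in `[0, 1]) (k * (w (S t) * g t)).
  by apply: eq_Rintegral => t /set_mem t01; rewrite /M tauK// /g Ering.
rewrite RintegralZl//; last exact: integ.
rewrite ler_wpM2l//; first by rewrite divr_ge0// ltW.
apply: le_trans (weighted_hoelder _ q1 _ _ _ _ (integ _ _ _ cwS) (integ _ _ _ cwgq)) _ => //.
- by apply: subspace_continuous_measurable_fun.
- by apply: subspace_continuous_measurable_fun.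
- by move=> t t01; apply: w0; exact: harm_itp_in.
- by move=> t t01; rewrite mulr_ge0 ?sqr_ge0 ?powR_ge0.
rewrite le_eqVlt; apply/orP; left; apply/eqP; congr (_ * _ `^ _).
have Ering2 (t y s : R) : s * (y * v t) = s * (t * y * A + (1 - t) * y * B).
  by rewrite /v; ring.
by apply: eq_Rintegral => t /set_mem t01; rewrite gq// Ering2.
Qed.

End harmonic_interpolation_bound.

(** * Integrability, the bound from harmonic convexity, and the harmonic mean *)

Lemma integrable_continuousM_bounded (R : realType) (a b K : R) (u v : R -> R)
    (cu : {within `[a, b], continuous u}) (mv : measurable_fun `[a, b] v)
    (vK : forall x, x \in `[a, b] -> `|v x| <= K) :
  (@lebesgue_measure R).-integrable `[a, b] (EFin \o (fun x => u x * v x)).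
Proof.
have iuK : (@lebesgue_measure R).-integrable `[a, b] (EFin \o (fun x => u x * K)).
  apply: continuous_compact_integrable; first exact: segment_compact.
  by apply: (within_continuousM cu) => x; exact: cvg_cst.
apply: le_integrable iuK => //.
  apply/measurable_EFinP; apply: measurable_funM => //.
  exact: subspace_continuous_measurable_fun.
move=> x xab /=; rewrite lee_fin !normrM ler_wpM2l//.
by rewrite (le_trans (vK x xab))// ler_norm.
Qed.

(** Every point of [a, b] is a harmonic interpolate of [a] and [b], and both weights t and 1 - t are
    at most 1. *)
Lemma harmonically_convex_bound (R : realType) (a b : R) (psi : R -> R) :
  0 < a * b -> a < b -> harmonically_convex a b psi ->
  (forall x, x \in `[a, b] -> 0 <= psi x) ->
  forall x, x \in `[a, b] -> psi x <= psi a + psi b.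
Proof.
move=> ab0 ab hc psi0 x xab.
have aab : a \in `[a, b] by rewrite in_itv/= lexx ltW.
have bab : b \in `[a, b] by rewrite in_itv/= lexx ltW.
have ab' : a != b by rewrite lt_eqF.
have := @harm_itp_surj R a b ab0 ab' x.
rewrite (min_idPl (ltW ab)) (max_idPr (ltW ab)) => /(_ xab)[t t01 <-].
have := hc b a t bab aab t01; rewrite [b * a]mulrC => /le_trans; apply.
move: t01; rewrite in_itv/= => /andP[t0 t1].
by rewrite lerD// ler_piMl ?psi0// gerBl.
Qed.

(** 1 / H is the midpoint of 1 / a and 1 / b, so 1/a - 1/H = 1/H - 1/b = (b - a) / (2ab): the two
    halves have the same substitution constant. *)
Lemma Hmean_between (R : realType) (a b : R) : 0 < a * b -> a < b ->
  [/\ a < Hmean a b < b, 0 < a * Hmean a b, 0 < b * Hmean a b,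
      (Hmean a b - a) / (a * Hmean a b) = (b - a) / (2 * a * b) &
      (b - Hmean a b) / (b * Hmean a b) = (b - a) / (2 * a * b)].
Proof.
move=> ab0 ab.
have a0 : a != 0 by apply: contraTneq ab0 => ->; rewrite mul0r ltxx.
have b0 : b != 0 by apply: contraTneq ab0 => ->; rewrite mulr0 ltxx.
have aa : 0 < a ^+ 2 by rewrite exprn_even_gt0.
have bb : 0 < b ^+ 2 by rewrite exprn_even_gt0.
have s2 : 0 < (a + b) ^+ 2 by rewrite sqrrD; rewrite addr_gt0// addr_gt0// mulrn_wgt0.
have s0 : a + b != 0 by apply: contraTneq s2 => ->; rewrite expr0n/= ltxx.
have ba0 : 0 < b - a by rewrite subr_gt0.
rewrite /Hmean; split.
- apply/andP; split; rewrite -subr_gt0.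
    rewrite (_ : _ - _ = (b - a) * (a ^+ 2 + a * b) / (a + b) ^+ 2); last by field.
    by rewrite divr_gt0// mulr_gt0// addr_gt0.
  rewrite (_ : _ - _ = (b - a) * (b ^+ 2 + a * b) / (a + b) ^+ 2); last by field.
  by rewrite divr_gt0// mulr_gt0// addr_gt0.
- rewrite (_ : _ * _ = (a * b) * (a ^+ 2 + a * b) * 2 / (a + b) ^+ 2); last by field.
  by rewrite divr_gt0// mulr_gt0// mulr_gt0// addr_gt0.
- rewrite (_ : _ * _ = (a * b) * (b ^+ 2 + a * b) * 2 / (a + b) ^+ 2); last by field.
  by rewrite divr_gt0// mulr_gt0// mulr_gt0// addr_gt0.
- by field; rewrite a0 b0 s0.
- by field; rewrite a0 b0 s0.
Qed.

Lemma within_continuousB_cst_norm (R : realType) (A : set R) (h : R -> R) (k c : R) :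
  {within A, continuous h} -> {within A, continuous (fun x => `|k * h x - c|)}.
Proof.
move=> /subspace_continuousP ch; apply/subspace_continuousP => x Ax.
apply: cvg_norm; apply: cvgB; last exact: cvg_cst.
by apply: cvgM; [exact: cvg_cst|exact: ch].
Qed.

(** * Integration by parts, splitting at the harmonic mean, and summation of the two estimates *)

Theorem theorem7 (R : realType) (I : set R) (a b q : R) (f h : R -> R)
    (I_itv : is_interval I) (I_n0 : ~ I 0)
    (Ia : I a) (Ib : I b) (ab : a < b) (q1 : 1 < q)
    (df_int : forall x : R, I° x -> derivable f x 1)
    (df_ab : forall x : R, x \in `[a, b] -> derivable_within I f x)
    (h_ge0 : forall x : R, x \in `[a, b] -> 0 <= h x)
    (dh : forall x : R, x \in `[a, b] -> derivable_within `[a, b] h x)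
    (int_fh' : (@lebesgue_measure R).-integrable `[a, b]
       (EFin \o (fun x : R => f x * derive_within `[a, b] h x)))
    (hc : harmonically_convex a b (fun x : R => `|derive_within I f x| `^ q)) :
  let mu := @lebesgue_measure R in
  let f' := derive_within I f in
  let h' := derive_within `[a, b] h in
  let H := Hmean a b in
  let L := Lpt a b in
  let U := Upt a b in
  `| (h b - 2 * h a) * (f a / 2) + h b * (f b / 2)
     - \int[mu]_(x in `[a, b]) (f x * h' x) |
  <= (b - a) / (4 * a * b) *
     ((\int[mu]_(t in `[0, 1]) `|2 * h (L t) - h b|) `^ (1 - q^-1) *
      (\int[mu]_(t in `[0, 1])
         (`|2 * h (L t) - h b| *
          (t * (L t ^+ 2) `^ q * `|f' a| `^ q
           + (1 - t) * (L t ^+ 2) `^ q * `|f' H| `^ q))) `^ q^-1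
      +
      (\int[mu]_(t in `[0, 1]) `|2 * h (U t) - h b|) `^ (1 - q^-1) *
      (\int[mu]_(t in `[0, 1])
         (`|2 * h (U t) - h b| *
          (t * (U t ^+ 2) `^ q * `|f' b| `^ q
           + (1 - t) * (U t ^+ 2) `^ q * `|f' H| `^ q))) `^ q^-1).
Proof.
(* The lets sit under the coercion [is_true], out of reach of [move=>]. *)
lazy zeta; set mu := @lebesgue_measure R; set f' := derive_within I f.
set h' := derive_within `[a, b] h; set H := Hmean a b; set L := Lpt a b; set U := Upt a b.
have q0 : 0 < q by exact: lt_trans q1.
(* If a b <= 0 with a < b, then 0 lies between [a] and [b], hence in the interval [I]. *)
have ab0 : 0 < a * b.
  rewrite ltNge; apply/negP => ab_le0; apply: I_n0; apply: (I_itv a b) => //.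
  by apply/andP; split; rewrite leNgt; apply/negP => ?; nra.
have aab : a \in `[a, b] by rewrite in_itv/= lexx ltW.
have bab : b \in `[a, b] by rewrite in_itv/= lexx ltW.
have [/andP[aH Hb] aH0 bH0 kaH kbH] := Hmean_between ab0 ab.
rewrite -/H in aH Hb aH0 bH0 kaH kbH.
have Hab : H \in `[a, b] by rewrite in_itv/= !ltW.
have abI : `[a, b]%classic `<=` I.
  by move=> x /=; rewrite in_itv/= => xab; exact: (I_itv a b).
have df : deriv_on a b f f' by exact: derivable_within_deriv_on.
have dh' : deriv_on a b h h' by exact: derivable_within_deriv_on.
have ch := deriv_on_continuous dh'.
have mf' := measurable_deriv_on df.
(* Harmonic convexity makes f' bounded on [a, b], which yields the integrability of u f' and w |f'|
   below. *)
pose K := (`|f' a| `^ q + `|f' b| `^ q) `^ q^-1.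
have f'K x : x \in `[a, b] -> `|f' x| <= K.
  move=> xab; have := harmonically_convex_bound ab0 ab hc _ xab.
  move=> /(_ (fun _ _ => powR_ge0 _ _)) HK.
  have qn0 : q != 0 by rewrite gt_eqF.
  rewrite -[leLHS](powRr1 (normr_ge0 _)) -(mulfV qn0) powRrM.
  by rewrite ge0_ler_powR// ?nnegrE ?powR_ge0 ?addr_ge0 ?powR_ge0// invr_ge0 ltW.
(* Shifting [h] by h(b)/2 keeps its derivative and turns the boundary term u(b) f(b) - u(a) f(a)
   into the bracket of the statement. *)
pose u x := h x - h b / 2.
have du : deriv_on a b u h'.
  move=> x xab e e0; near=> y => yab.
  rewrite (_ : u y - u x = h y - h x); last by rewrite /u; ring.
  by move: yab; near: y; exact: dh'.
have cu := deriv_on_continuous du.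
have iuf' : mu.-integrable `[a, b] (EFin \o (fun x => u x * f' x)).
  exact: integrable_continuousM_bounded f'K.
have LHSE : (h b - 2 * h a) * (f a / 2) + h b * (f b / 2)
     - \int[mu]_(x in `[a, b]) (f x * h' x) = \int[mu]_(x in `[a, b]) (u x * f' x).
  have iD : mu.-integrable `[a, b] (EFin \o (fun x => h' x * f x + u x * f' x)).
    have : mu.-integrable `[a, b] (fun x => (f x * h' x)%:E + (u x * f' x)%:E)%E.
      by apply: (integrableD _ int_fh' iuf').
    by apply: eq_integrable => // x _ /=; rewrite [h' x * f x]mulrC.
  have := integral_deriv_on (ltW ab) (deriv_onM du df) iD.
  have -> : \int[@lebesgue_measure R]_(x in `[a, b]) (h' x * f x + u x * f' x) =
    \int[@lebesgue_measure R]_(x in `[a, b]) (f x * h' x + u x * f' x).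
    by apply: eq_Rintegral => x _; rewrite [h' x * f x]mulrC.
  rewrite RintegralD// => E.
  by apply/eqP; rewrite subr_eq [eqbRHS]addrC E /u; apply/eqP; field.
rewrite LHSE; apply: le_trans (le_normr_Rintegral _ iuf') _ => //.
pose w x := `|2 * h x - h b| : R.
have cw : {within `[a, b], continuous w} by exact: within_continuousB_cst_norm.
have iw : mu.-integrable `[a, b] (EFin \o (fun x => w x * `|f' x|)).
  apply: (@integrable_continuousM_bounded _ _ _ K) => //.
    exact: measurableT_comp.
  by move=> x xab; rewrite normr_id f'K.
have -> : \int[mu]_(x in `[a, b]) `|u x * f' x| =
    2^-1 * \int[mu]_(x in `[a, b]) (w x * `|f' x|).
  rewrite -RintegralZl//; apply: eq_Rintegral => x _.
  rewrite normrM /w (_ : 2 * h x - h b = 2 * u x); last by rewrite /u; field.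
  by rewrite normrM (gtr0_norm (ltr0n _ 2)) !mulrA mulVf ?mul1r.
have aHb : `[a, H]%classic `<=` `[a, b]%classic by apply: subset_itvl; rewrite bnd_simp ltW.
have Hbb : `[H, b]%classic `<=` `[a, b]%classic by apply: subset_itvr; rewrite bnd_simp ltW.
have -> : \int[mu]_(x in `[a, b]) (w x * `|f' x|) =
    \int[mu]_(x in `[a, H]) (w x * `|f' x|) + \int[mu]_(x in `[H, b]) (w x * `|f' x|).
  (* The point [H] belongs to both closed halves; being null, it is first removed from the right
     one. *)
  rewrite -(Rintegral_itv_obnd_cbnd (r := H)); last first.
    by apply: integrableS iw => //; apply: subset_trans Hbb; exact: subset_itv_oc_cc.
  by rewrite -(Rintegral_itvB iw) ?bnd_simp ?ltW// addrC subrK.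
have iL : mu.-integrable `[a, H] (EFin \o (fun x => w x * `|f' x|)) by exact: integrableS iw.
have iU : mu.-integrable `[H, b] (EFin \o (fun x => w x * `|f' x|)) by exact: integrableS iw.
have aH' : a != H by rewrite lt_eqF.
have bH' : b != H by rewrite gt_eqF.
(* On the left half the interpolation runs down from [H] to [a], on the right half up from [H] to
   [b], so the minimum is [a] in the first case and [H] in the second. *)
have JL : Interval (BLeft (Num.min a H)) (BRight (Num.max a H)) = `[a, H].
  by rewrite (min_idPl (ltW aH)) (max_idPr (ltW aH)).
have JU : Interval (BLeft (Num.min b H)) (BRight (Num.max b H)) = `[H, b].
  by rewrite (min_idPr (ltW Hb)) (max_idPl (ltW Hb)).
have := @harm_itp_hoelder R a H aH0 aH' q (`|f' a| `^ q) (`|f' H| `^ q) w f' q1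
  (powR_ge0 _ _) (powR_ge0 _ _).
rewrite JL => /(_ (continuous_subspaceW aHb cw) (fun _ _ => normr_ge0 _)).
move=> /(_ iL) HL.
have := @harm_itp_hoelder R b H bH0 bH' q (`|f' b| `^ q) (`|f' H| `^ q) w f' q1
  (powR_ge0 _ _) (powR_ge0 _ _).
rewrite JU => /(_ (continuous_subspaceW Hbb cw) (fun _ _ => normr_ge0 _)).
move=> /(_ iU) HU.
have hcH c t : c \in `[a, b] -> t \in `[0, 1] ->
    `|f' (harm_itp c H t)| `^ q <= t * `|f' c| `^ q + (1 - t) * `|f' H| `^ q.
  by move=> cab t01; rewrite /harm_itp [c * H]mulrC; exact: hc.
have {}HL := HL (fun t => hcH a t aab).
have {}HU := HU (fun t => hcH b t bab).
rewrite gtr0_norm ?subr_gt0// kaH in HL.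
rewrite ltr0_norm ?subr_lt0// opprB kbH in HU.
(* The factor 1/2 from |u| = w / 2 and the common substitution constant (b - a) / (2ab) combine into
   (b - a) / (4ab). *)
have half (X Y : R) : 2^-1 * ((b - a) / (2 * a * b) * X + (b - a) / (2 * a * b) * Y) =
    (b - a) / (4 * a * b) * (X + Y).
  by have := lt0r_neq0 ab0; rewrite mulf_eq0 negb_or => /andP[a0 b0]; field; rewrite a0 b0.
move: HL HU; rewrite /w /harm_itp => HL HU.
rewrite /L /U /Lpt /Upt -/H /mu -half.
apply: ler_wpM2l; first by rewrite invr_ge0.
exact: lerD HL HU.
Unshelve. all: by end_near.
Qed.
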